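(* Let $G$ be a finite non-abelian $2$-group. Then $$\frac{\mathcal{V}(G)}{|G|}<\frac{1}{2\sqrt{10}}.$$
   Context: For a finite group $G$, $L(G)$ denotes the set of all subgroups of $G$ (including the trivial subgroup and $G$ itself), $s(G)$ denotes the number of subgroups of $G$ that are simple groups (the trivial group is not simple; cyclic groups of prime order are simple), and $\mathcal{V}(G)=s(G)/|L(G)|$. *)

(* Defs.v *)
From mathcomp Require Import all_boot all_order all_algebra all_fingroup all_solvable.

Set Implicit Arguments.
Unset Strict Implicit.
Unset Printing Implicit Defensive.

Import GRing.Theory Num.Theory.
Local Open Scope ring_scope.

(* [simple] excludes the trivial group and does not require non-commutativity,
   so cyclic groups of prime order are counted. *)
Definition simple_subgroups (gT : finGroupType) (G : {group gT}) :
    {set {group gT}} :=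
  [set H in subgroups G | simple H].

Definition simple_ratio (R : unitRingType) (gT : finGroupType)
    (G : {group gT}) : R :=
  #|simple_subgroups G|%:R / #|subgroups G|%:R.

(* Main.v *)
(** The ratio is at most 1/8: a simple subgroup is a subgroup, so
    [V(G) <= 1], and groups of order [p ^ n] with [n <= 2] are abelian, so
    [|G| >= 8].  Finally [1/8 < 1 / (2 sqrt 10)] because [10 < 4 ^ 2]. *)
Require Import Defs.
From mathcomp Require Import all_boot all_order all_algebra all_fingroup all_solvable.

Set Implicit Arguments.
Unset Strict Implicit.
Unset Printing Implicit Defensive.

Import GRing.Theory Num.Theory.
Local Open Scope ring_scope.

Lemma nonabelian_pgroup_card (gT : finGroupType) (G : {group gT}) (p : nat) :
  prime p -> (p.-group G)%g -> ~~ abelian G -> (p ^ 3 <= #|G|)%N.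
Proof.
move=> p_pr pG nabG; rewrite (card_pgroup pG) leq_pexp2l ?prime_gt0 // ltnNge.
apply: contra nabG => le_n2; case: (ltngtP (logn p #|G|) 2) le_n2 => // [lt_n2|n2] _.
  (* Exponent 0 or 1: [G] is trivial or of prime order, hence cyclic. Exponent 2 is left to
     [p2group_abelian]. *)
  apply: cyclic_abelian; case n1: (logn p #|G|) lt_n2 => [|[|//]] _.
    by have /card1_trivg -> : #|G| = 1%N; [rewrite (card_pgroup pG) n1 | exact: cyclic1].
  by apply: prime_cyclic; rewrite (card_pgroup pG) n1 expn1.
by apply: (p2group_abelian pG); rewrite n2.
Qed.

Lemma simple_ratio_le1 (R : numFieldType) (gT : finGroupType) (G : {group gT}) :
  simple_ratio R G <= 1.
Proof.
have L_gt0 : (0 < #|subgroups G|)%N.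
  by apply/card_gt0P; exists G; rewrite inE subxx.
rewrite /simple_ratio ler_pdivrMr ?ltr0n // mul1r ler_nat subset_leq_card //.
by apply/subsetP => H; rewrite inE => /andP[].
Qed.

Theorem proposition2p13 (R : rcfType) (gT : finGroupType) (G : {group gT})
  (pG : (2.-group G)%g) (nabG : ~~ abelian G) :
  simple_ratio R G / #|G|%:R < 1 / (2 * Num.sqrt 10).
Proof.
have cardG : (8 <= #|G|)%N := nonabelian_pgroup_card (isT : prime 2) pG nabG.
have sqrt10_lt4 : Num.sqrt 10 < 4 :> R.
  (* Writing [4] as the square root of [4 ^+ 2] reduces the claim, by monotonicity of the root, to
     [10 < 16]. *)
  rewrite -[ltRHS]ger0_norm ?ler0n // -sqrtr_sqr ltr_sqrt ?exprn_gt0 ?ltr0n //.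
  by rewrite -natrX ltr_nat.
have sqrt10_gt0 : 0 < Num.sqrt 10 :> R by rewrite sqrtr_gt0 ltr0n.
apply: (@Order.POrderTheory.le_lt_trans _ _ (1 / 8)).
  (* Factorwise comparison of nonnegative terms: the ratio against 1, the inverse of [#|G|] against
     that of 8. *)
  rewrite ler_pM ?invr_ge0 ?ler0n ?simple_ratio_le1 ?divr_ge0 ?ler0n //.
  by rewrite lef_pV2 ?posrE ?ltr0n ?ler_nat // (leq_trans _ cardG).
rewrite !mul1r ltf_pV2 ?posrE ?mulr_gt0 ?ltr0n //.
(* Reading 8 as [2 * 4] lets the factor 2 cancel, which leaves [sqrt10_lt4]. *)
by rewrite (natrM R 2 4) ltr_pM2l ?ltr0n.
Qed.
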